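(* Let $\rho>0$, let $Q\in\mathbb R^{n_{\mathrm f}\times n_{\mathrm f}}$ be symmetric positive definite, and let $g:\mathbb R^m\to\mathbb R$ be $$g(\lambda)=-\tfrac12\lambda^\top A_{\mathrm f}Q^{-1}A_{\mathrm f}^\top\lambda+\lambda^\top(A_{\mathrm f}Q^{-1}w_{\mathrm f}+b)-\tfrac12w_{\mathrm f}^\top Q^{-1}w_{\mathrm f}-\tfrac\rho2\sum_{j=1}^{m_{\mathrm{sos}}}\Bigl\|\mathcal P_{\mathbb S_+^{h_j}}\bigl(\tfrac1\rho({A_{\mathrm{sos}}^{(j)}}^\top\lambda-w_{\mathrm{sos}}^{(j)})\bigr)\Bigr\|_2^2 .$$ Then the gradient $\nabla g:\mathbb R^m\to\mathbb R^m$ of $g$ is $$\nabla g(\lambda)=-A_{\mathrm f}Q^{-1}A_{\mathrm f}^\top\lambda+A_{\mathrm f}Q^{-1}w_{\mathrm f}+b-\sum_{j=1}^{m_{\mathrm{sos}}}A_{\mathrm{sos}}^{(j)}\,\mathcal P_{\mathbb S_+^{h_j}}\bigl(\tfrac1\rho({A_{\mathrm{sos}}^{(j)}}^\top\lambda-w_{\mathrm{sos}}^{(j)})\bigr),$$ and $\nabla g$ is Lipschitz continuous (with respect to the Euclidean norm) with constant $$L=\bigl\|A_{\mathrm f}Q^{-1}A_{\mathrm f}^\top\bigr\|_2+\frac1\rho\Bigl\|\sum_{j=1}^{m_{\mathrm{sos}}}A_{\mathrm{sos}}^{(j)}{A_{\mathrm{sos}}^{(j)}}^\top\Bigr\|_2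 .$$
   Context: Data: integers $m,n_{\mathrm f},m_{\mathrm{sos}},h_j\ge1$; $A_{\mathrm f}\in\mathbb R^{m\times n_{\mathrm f}}$, $w_{\mathrm f}\in\mathbb R^{n_{\mathrm f}}$, $b\in\mathbb R^m$, and for $j=1,\dots,m_{\mathrm{sos}}$, $A_{\mathrm{sos}}^{(j)}\in\mathbb R^{m\times h_j(h_j+1)/2}$, $w_{\mathrm{sos}}^{(j)}\in\mathbb R^{h_j(h_j+1)/2}$. $\|\cdot\|_2$ is the Euclidean norm for vectors and the spectral norm for matrices. Vectorization: for a symmetric $h\times h$ matrix $X$, $\operatorname{svec}(X)\in\mathbb R^{h(h+1)/2}$ stacks its upper triangular entries with off-diagonal entries multiplied by $\sqrt2$ (so $\|X\|_{\mathrm F}=\|\operatorname{svec}(X)\|_2$), and $\operatorname{smat}$ is its inverse. A vector $\zeta\in\mathbb R^{h(h+1)/2}$ is identified with $\operatorname{smat}(\zeta)$; $\mathcal P_{\mathbb S_+^h}(\zeta)$ denotes the Euclidean projection of $\zeta$ onto $\{\zeta:\operatorname{smat}(\zeta)\text{ positive semidefinite}\}$, i.e. $\operatorname{svec}$ of the Frobenius projection of $\operatorname{smat}(\zeta)$ onto the positive semidefinite cone. *)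

(* Defs.v *)
From HB Require Import structures.
From mathcomp Require Import all_boot all_order all_algebra.
From mathcomp Require Import all_classical all_reals all_analysis.
Import Order.TTheory GRing.Theory Num.Theory.
Import numFieldNormedType.Exports.

Set Implicit Arguments.
Unset Strict Implicit.
Unset Printing Implicit Defensive.

Local Open Scope classical_set_scope.
Local Open Scope ring_scope.

(* The norm that MathComp-Analysis puts on matrices is the max norm, hence the
   explicit Euclidean and spectral norms. *)
Definition enorm (R : realType) (n : nat) (x : 'cV[R]_n) : R :=
  Num.sqrt (\sum_(i < n) x i 0 ^+ 2).

(* Operator norm induced by the Euclidean norms. *)
Definition spectral_norm (R : realType) (m n : nat) (A : 'M[R]_(m, n)) : R :=
  sup [set enorm (A *m x) | x in [set x : 'cV[R]_n | enorm x <= 1]].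

Definition psdmx (R : realType) (n : nat) (X : 'M[R]_n) : Prop :=
  X^T = X /\ forall x : 'cV[R]_n, 0 <= (x^T *m X *m x) 0 0.

Definition pdmx (R : realType) (n : nat) (X : 'M[R]_n) : Prop :=
  X^T = X /\ forall x : 'cV[R]_n, x != 0 -> 0 < (x^T *m X *m x) 0 0.

(* Vector of partial derivatives; it is the gradient where [f] is
   differentiable. *)
Definition gradient (R : realType) (m : nat) (f : 'cV[R]_m -> R)
    (x : 'cV[R]_m) : 'cV[R]_m :=
  \col_(i < m) 'D_(delta_mx i 0) f x.

Definition svec_dim (h : nat) : nat := (h * h.+1)./2.

Lemma svec_dimE (h : nat) : svec_dim h = 'C(h.+1, 2).
Proof. by rewrite /svec_dim bin2 /= mulnC. Qed.

Lemma triu_pos_subproof (h : nat) (i j : 'I_h) :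
  ('C((maxn i j).+1, 2) + minn i j < svec_dim h)%N.
Proof.
have lt_max : (maxn i j < h)%N by rewrite gtn_max !ltn_ord.
rewrite svec_dimE; apply: (@leq_trans 'C((maxn i j).+2, 2)).
  rewrite [X in (_ < X)%N]binS bin1 ltn_add2l ltnS.
  by rewrite geq_min leq_maxl.
by rewrite leq_bin2l.
Qed.

(* The upper triangle is stacked column by column: entry (i, j), i <= j, sits
   at position j(j+1)/2 + i.  The position is symmetric in i and j. *)
Definition triu_pos (h : nat) (i j : 'I_h) : 'I_(svec_dim h) :=
  Ordinal (triu_pos_subproof i j).

Definition svec (R : realType) (h : nat) (X : 'M[R]_h) : 'cV[R]_(svec_dim h) :=
  \col_k \sum_(p : 'I_h * 'I_h | (p.1 <= p.2)%N && (triu_pos p.1 p.2 == k))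
    (if p.1 == p.2 then 1 else Num.sqrt 2) * X p.1 p.2.

Definition smat (R : realType) (h : nat) (z : 'cV[R]_(svec_dim h)) : 'M[R]_h :=
  \matrix_(i, j) ((if i == j then 1 else (Num.sqrt 2)^-1) * z (triu_pos i j) 0).

Lemma triu_posC (h : nat) (i j : 'I_h) : triu_pos i j = triu_pos j i.
Proof. by apply/val_inj; rewrite /= maxnC minnC. Qed.

Lemma triu_pos_inj (h : nat) (i j i' j' : 'I_h) : (i <= j)%N -> (i' <= j')%N ->
  triu_pos i j = triu_pos i' j' -> (i, j) = (i', j').
Proof.
have aux (a b a' b' : nat) : (a <= b)%N -> (b < b')%N ->
    ('C(b.+1, 2) + a < 'C(b'.+1, 2) + a')%N.
  move=> ab bb'; apply: (@leq_trans 'C(b.+2, 2)).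
    by rewrite [X in (_ < X)%N]binS bin1 ltn_add2l ltnS.
  by apply: leq_trans (leq_addr _ _); rewrite leq_bin2l.
move=> ij i'j' /(congr1 val) /=.
rewrite (maxn_idPr ij) (minn_idPl ij) (maxn_idPr i'j') (minn_idPl i'j').
case: (ltngtP j j') => [lt|lt|/val_inj <-] e.
- by have := aux _ _ i' _ ij lt; rewrite e ltnn.
- by have := aux _ _ i _ i'j' lt; rewrite e ltnn.
- by move/addnI: e => /val_inj ->.
Qed.

Lemma triu_pos_surj (h : nat) (k : 'I_(svec_dim h)) :
  exists2 p : 'I_h * 'I_h, (p.1 <= p.2)%N & triu_pos p.1 p.2 = k.
Proof.
have aux n l : (l < 'C(n.+1, 2))%N ->
    exists i j, [/\ (i <= j)%N, (j < n)%N & l = ('C(j.+1, 2) + i)%N].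
  elim: n => [//|n IHn]; rewrite binS bin1 => ln.
  have [/IHn[i [j [ij jn ->]]]|le] := ltnP l 'C(n.+1, 2).
    by exists i, j; split=> //; exact: ltnW.
  exists (l - 'C(n.+1, 2))%N, n; split=> //; last by rewrite subnKC.
  by rewrite leq_subLR -ltnS -addnS.
have /aux[i [j [ij jh kE]]] : (k < 'C(h.+1, 2))%N by rewrite -svec_dimE.
exists (Ordinal (leq_ltn_trans ij jh), Ordinal jh) => //.
by apply/val_inj; rewrite /= kE (maxn_idPr ij) (minn_idPl ij).
Qed.

Lemma svec_triu_pos (R : realType) (h : nat) (X : 'M[R]_h) (i j : 'I_h) :
  (i <= j)%N ->
  svec X (triu_pos i j) 0 = (if i == j then 1 else Num.sqrt 2) * X i j.
Proof.
move=> ij; rewrite mxE (big_pred1 (i, j)) // => -[a b] /=.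
apply/andP/eqP => [[ab /eqP]|[-> ->]]; last by rewrite ij eqxx.
by move/triu_pos_inj; apply.
Qed.

Lemma smatK (R : realType) (h : nat) :
  cancel (@smat R h) (@svec R h).
Proof.
move=> z; apply/colP => k; have [[i j] /= ij <-] := triu_pos_surj k.
rewrite svec_triu_pos // mxE; case: eqP => _; first by rewrite !mul1r.
by rewrite mulrA divff ?mul1r // gt_eqF // sqrtr_gt0.
Qed.

Lemma svecK (R : realType) (h : nat) (X : 'M[R]_h) :
  X^T = X -> smat (svec X) = X.
Proof.
have aux (Y : 'M[R]_h) (i j : 'I_h) : (i <= j)%N ->
    smat (svec Y) i j = Y i j.
  move=> ij; rewrite mxE svec_triu_pos //; case: eqP => _.
    by rewrite !mul1r.
  by rewrite mulrA mulVf ?mul1r // gt_eqF // sqrtr_gt0.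
move=> XT; apply/matrixP => i j; have [/aux //|/ltnW ji] := leqP i j.
transitivity (smat (svec X) j i); first by rewrite !mxE triu_posC eq_sym.
by rewrite aux // -[in RHS]XT mxE.
Qed.

(* The minimizer exists and is unique (nonempty closed convex set), so the
   default value 0 of [xget] is never used. *)
Definition psd_proj (R : realType) (h : nat) (z : 'cV[R]_(svec_dim h)) :
    'cV[R]_(svec_dim h) :=
  xget 0 [set p | psdmx (smat p) /\
    forall q, psdmx (smat q) -> enorm (z - p) <= enorm (z - q)].

(* Main.v *)
From HB Require Import structures.
Require Import Defs.
From mathcomp Require Import all_boot all_order all_algebra.
From mathcomp Require Import all_classical all_reals all_analysis.
From mathcomp Require Import ring lra.
Import Order.TTheory GRing.Theory Num.Theory.
Import numFieldNormedType.Exports.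
Local Open Scope ring_scope.

(** Why the theorem holds.  The only term of [g] that is not a quadratic
    polynomial is a sum of functions [phi z = 1/2 |P z|^2] precomposed with
    affine maps, where [P] is the projection onto a closed convex cone [K].

    By Moreau, [p = P z] is characterized by: [p] is in [K], [z - p] is
    orthogonal to [p], and [<z - p, q> <= 0] for all [q] in [K]
    ([moreau_pair], [psd_projP]).  These conditions give at once that [P] is
    1-Lipschitz ([moreau_nonexpansive]) and that [P z] is a subgradient of
    [phi] at [z] ([half_sqr_moreau_subgradient]).  Writing the subgradient
    inequality at [z] and at [z'] encloses the first-order remainder
    [phi z' - phi z - <P z, z' - z>] between [0] and
    [<P z' - P z, z' - z> <= |z' - z|^2]
    ([half_sqr_moreau_expansion]).  So [phi] is differentiable with gradient
    [P], although [P] itself need not be differentiable.  The argument applies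
    to the positive semidefinite matrices because they form a closed convex
    cone.

    Summing the expansions, the first-order remainder of [g] at any point is
    at most a constant times [|u|^2], which gives differentiability and the
    formula of the gradient ([quadratic_remainder_gradient]).

    For the Lipschitz constant, let [e = x - y], [S = \sum_j A_j A_j^T], and
    let [d_j] be the difference of the projections of block [j].
    Nonexpansiveness gives
    [\sum_j |d_j|^2 <= rho^-2 \sum_j |A_j^T e|^2 = rho^-2 <e, S e>], and
    Cauchy-Schwarz over the stacked blocks gives
    [|\sum_j A_j d_j|^2 <= |S| \sum_j |d_j|^2] ([dot_sum_mulmx_le]).
    Together, [|\sum_j A_j d_j| <= rho^-1 |S| |e|]; keeping the blocks
    together is what yields the norm of the sum [S] instead of a sum of
    norms. *)

Set Implicit Arguments.
Unset Strict Implicit.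
Unset Printing Implicit Defensive.

(** * Euclidean inner product *)

Definition dot (R : realType) (n : nat) (x y : 'cV[R]_n) : R := (x^T *m y) 0 0.

Section Dot.
Context {R : realType} {n : nat}.
Implicit Types x y z : 'cV[R]_n.

Lemma dotE x y : dot x y = \sum_i x i 0 * y i 0.
Proof. by rewrite /dot mxE; apply: eq_bigr => i _; rewrite mxE. Qed.

Lemma dotC x y : dot x y = dot y x.
Proof. by rewrite !dotE; apply: eq_bigr => i _; rewrite mulrC. Qed.

Lemma dotDr x y z : dot x (y + z) = dot x y + dot x z.
Proof. by rewrite /dot mulmxDr mxE. Qed.

Lemma dotZr (a : R) x y : dot x (a *: y) = a * dot x y.
Proof. by rewrite /dot -scalemxAr mxE. Qed.

Lemma dotNr x y : dot x (- y) = - dot x y.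
Proof. by rewrite -scaleN1r dotZr mulN1r. Qed.

Lemma dot0r x : dot x 0 = 0.
Proof. by rewrite -(scale0r 0) dotZr mul0r. Qed.

Lemma dotDl x y z : dot (y + z) x = dot y x + dot z x.
Proof. by rewrite dotC dotDr !(dotC x). Qed.

Lemma dotZl (a : R) x y : dot (a *: x) y = a * dot x y.
Proof. by rewrite dotC dotZr dotC. Qed.

Lemma dotNl x y : dot (- x) y = - dot x y.
Proof. by rewrite dotC dotNr dotC. Qed.

Definition dot_lin := (dotDl, dotDr, dotNl, dotNr, dotZl, dotZr).

Lemma dot_sumr (I : finType) (F : I -> 'cV[R]_n) x :
  dot x (\sum_i F i) = \sum_i dot x (F i).
Proof. by rewrite /dot mulmx_sumr summxE. Qed.

Lemma dot_ge0 x : 0 <= dot x x.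
Proof. by rewrite dotE; apply: sumr_ge0 => i _; rewrite -expr2 sqr_ge0. Qed.

Lemma dot_eq0 x : dot x x = 0 -> x = 0.
Proof.
rewrite dotE => /psumr_eq0P x0; apply/colP => i; rewrite mxE.
by apply/eqP; rewrite -sqrf_eq0 expr2 x0 // => j _; rewrite -expr2 sqr_ge0.
Qed.

Lemma enormE x : enorm x = Num.sqrt (dot x x).
Proof. by rewrite /enorm dotE. Qed.

Lemma enorm_ge0 x : 0 <= enorm x.
Proof. exact: sqrtr_ge0. Qed.

Lemma sqr_enorm x : enorm x ^+ 2 = dot x x.
Proof. by rewrite enormE sqr_sqrtr // dot_ge0. Qed.

Lemma enormZ (a : R) x : enorm (a *: x) = `|a| * enorm x.
Proof.
by rewrite !enormE !dot_lin mulrA -expr2 sqrtrM ?sqr_ge0 // sqrtr_sqr.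
Qed.

Lemma enorm0 : enorm (0 : 'cV[R]_n) = 0.
Proof. by rewrite enormE dot0r sqrtr0. Qed.

Lemma enorm_le (x y : 'cV[R]_n) : (enorm x <= enorm y) = (dot x x <= dot y y).
Proof. by rewrite !enormE ler_sqrt // dot_ge0. Qed.

(** Cauchy-Schwarz: expand the squared norm of [<y, y> x - <x, y> y], which is
    [<y, y>] times the difference of the two sides. *)
Lemma dot_sqr_le x y : dot x y ^+ 2 <= dot x x * dot y y.
Proof.
have [y0|yn0] := eqVneq (dot y y) 0.
  by rewrite (dot_eq0 y0) !dot0r mulr0 expr0n.
have ygt0 : 0 < dot y y by rewrite lt_def yn0 dot_ge0.
have := dot_ge0 (dot y y *: x - dot x y *: y).
rewrite !dot_lin (dotC y x) => h.
rewrite -subr_ge0 -(pmulr_rge0 _ ygt0); apply: le_trans h _.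
by rewrite le_eqVlt; apply/orP; left; apply/eqP; ring.
Qed.

Lemma abs_dot_le x y : `|dot x y| <= enorm x * enorm y.
Proof.
rewrite -[leRHS]ger0_norm; last by rewrite mulr_ge0 ?enorm_ge0.
rewrite -ler_sqr ?nnegrE // !real_normK ?num_real //.
by rewrite exprMn !sqr_enorm dot_sqr_le.
Qed.

Lemma dot_le x y : dot x y <= enorm x * enorm y.
Proof. exact: le_trans (ler_norm _) (abs_dot_le x y). Qed.

Lemma enormD x y : enorm (x + y) <= enorm x + enorm y.
Proof.
rewrite -ler_sqr ?nnegrE ?addr_ge0 ?enorm_ge0 // sqrrD !sqr_enorm !dot_lin.
have := dot_le x y; rewrite (dotC y x); lra.
Qed.

End Dot.

Lemma dot_adj (R : realType) (m n : nat) (A : 'M[R]_(m, n)) x y :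
  dot (A *m x) y = dot x (A^T *m y).
Proof. by rewrite /dot trmx_mul mulmxA. Qed.

(** * Spectral norm *)

(** The Frobenius norm bounds the set, by Cauchy-Schwarz on each row; without
    this the supremum defining [spectral_norm] would be a default value. *)
Lemma has_sup_spectral (R : realType) (m n : nat) (A : 'M[R]_(m, n)) :
  has_sup [set enorm (A *m x) | x in [set x : 'cV[R]_n | enorm x <= 1]]%classic.
Proof.
split; first by exists (enorm (A *m 0)), 0 => //=; rewrite enorm0 ler01.
exists (Num.sqrt (\sum_i dot (row i A)^T (row i A)^T)) => _ [x /= x1 <-].
rewrite enormE ler_sqrt; last by apply: sumr_ge0 => i _; rewrite dot_ge0.
rewrite dotE; apply: ler_sum => i _.
have -> : (A *m x) i 0 = dot (row i A)^T x.
  by rewrite dotE mxE; apply: eq_bigr => j _; rewrite !mxE.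
rewrite -expr2; apply: le_trans (dot_sqr_le _ _) _.
rewrite ler_piMr ?dot_ge0 // -sqr_enorm -[leRHS](expr1n _ 2).
by rewrite ler_sqr ?nnegrE ?enorm_ge0.
Qed.

Lemma enorm_mulmx (R : realType) (m n : nat) (A : 'M[R]_(m, n)) x :
  enorm (A *m x) <= spectral_norm A * enorm x.
Proof.
have [x0|xn0] := eqVneq (enorm x) 0.
  have /dot_eq0 -> : dot x x = 0 by rewrite -sqr_enorm x0 expr0n.
  by rewrite mulmx0 !enorm0 mulr0.
have xgt0 : 0 < enorm x by rewrite lt_def xn0 enorm_ge0.
rewrite -ler_pdivrMr //.
have -> : enorm (A *m x) / enorm x = enorm (A *m ((enorm x)^-1 *: x)).
  by rewrite -scalemxAr enormZ ger0_norm ?invr_ge0 ?enorm_ge0 // mulrC.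
apply: sup_upper_bound (has_sup_spectral A) _ _; eexists => //=.
by rewrite enormZ ger0_norm ?invr_ge0 ?enorm_ge0 // mulVf.
Qed.

Lemma spectral_norm_ge0 (R : realType) (m n : nat) (A : 'M[R]_(m, n)) :
  0 <= spectral_norm A.
Proof.
apply: le_trans (enorm_ge0 (A *m 0)) _.
apply: sup_upper_bound (has_sup_spectral A) _ _; eexists => //=.
by rewrite enorm0 ler01.
Qed.

Lemma abs_dot_mulmx_le (R : realType) (n : nat) (A : 'M[R]_n) x :
  `|dot x (A *m x)| <= spectral_norm A * dot x x.
Proof.
apply: le_trans (abs_dot_le _ _) _.
rewrite -sqr_enorm expr2 mulrCA ler_wpM2l ?enorm_ge0 //; exact: enorm_mulmx.
Qed.

Local Open Scope classical_set_scope.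

(** * Projection onto a convex cone *)

(** Moreau's characterization of [p] as the projection of [z] onto a closed
    convex cone [C]: [z - p] lies in the polar cone of [C] and is orthogonal to
    [p]. *)
Definition moreau_pair (R : realType) (n : nat) (C : set 'cV[R]_n)
    (z p : 'cV[R]_n) : Prop :=
  [/\ C p, dot (z - p) p = 0 & forall q, C q -> dot (z - p) q <= 0].

Section Moreau.
Context {R : realType} {n : nat} (C : set 'cV[R]_n).
Implicit Types z p : 'cV[R]_n.

(** The conditions at [z] and [z'] give firm nonexpansiveness
    [|p - p'|^2 <= <z - z', p - p'>]; the claim follows by expanding
    [|(z - z') - (p - p')|^2 >= 0]. *)
Lemma moreau_nonexpansive z z' p p' :
  moreau_pair C z p -> moreau_pair C z' p' ->
  dot (p - p') (p - p') <= dot (z - z') (z - z').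
Proof.
move=> [Cp zp0 zp] [Cp' zp0' zp'].
have := dot_ge0 (z - z' - (p - p')).
move: zp0 zp0' (zp _ Cp') (zp' _ Cp).
rewrite !dot_lin (dotC p' p) (dotC z' z) (dotC p z) (dotC p z') (dotC p' z)
  (dotC p' z').
lra.
Qed.

(** Since [|p|^2 = <z, p>] and [<p, z'> <= <p, p'>], the right side minus the
    left side is at least [1/2 |p' - p|^2]. *)
Lemma half_sqr_moreau_subgradient z z' p p' :
  moreau_pair C z p -> moreau_pair C z' p' ->
  dot p (z' - z) <= 2^-1 * dot p' p' - 2^-1 * dot p p.
Proof.
move=> [Cp zp0 _] [_ zp0' zp'].
have := dot_ge0 (p' - p); move: zp0 zp0' (zp' _ Cp).
rewrite !dot_lin (dotC p z) (dotC p z') (dotC p' p); lra.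
Qed.

(** The remainder is nonnegative by the subgradient inequality at [z]; by the
    one at [z'] it is at most [<p' - p, z' - z>], which nonexpansiveness
    bounds. *)
Lemma half_sqr_moreau_expansion z z' p p' :
  moreau_pair C z p -> moreau_pair C z' p' ->
  `|2^-1 * dot p' p' - 2^-1 * dot p p - dot p (z' - z)|
    <= dot (z' - z) (z' - z).
Proof.
move=> zp zp'.
have lo := half_sqr_moreau_subgradient zp zp'.
have hi := half_sqr_moreau_subgradient zp' zp.
have ne := moreau_nonexpansive zp' zp.
have sq := dot_ge0 (p' - p - (z' - z)).
rewrite ger0_norm; last lra.
move: hi ne sq; rewrite !dot_lin.
rewrite (dotC z p) (dotC z' p) (dotC z p') (dotC z' p') (dotC p' p) (dotC z' z).
lra.
Qed.

End Moreau.

(** Divide by [t] and let [t] tend to [0]. *)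
Lemma lin_quad_le0 (R : realType) (a b : R) :
  (forall t, 0 < t -> t <= 1 -> t * a <= t ^+ 2 * b) -> a <= 0.
Proof.
move=> h; rewrite leNgt; apply/negP => a0.
have b0 : 0 < b by have := h 1 ltr01 (lexx _); rewrite expr1n !mul1r; lra.
have d0 : 0 < 2 * (a + b) by lra.
(* If a > 0, then a <= b * t fails at t = a / (2 (a + b)), which lies in
   (0, 1]. *)
have t0 : 0 < a / (2 * (a + b)) by rewrite divr_gt0.
have := h _ t0; rewrite ler_pdivrMr // mul1r.
have -> : a <= 2 * (a + b) by lra.
rewrite expr2 -mulrA ler_pM2l // mulrAC ler_pdivlMr // => /(_ isT).
nra.
Qed.

(** First-order optimality of the closest point [p] along the segments
    [p + t u] that stay in [C]. The directions [u = q] give the polar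
    condition; [u = p] and [u = - p] are both admissible in a cone, hence the
    orthogonality. *)
Lemma closest_moreau_pair (R : realType) (n : nat) (C : set 'cV[R]_n)
    (z p : 'cV[R]_n) :
  (forall p q, C p -> C q -> C (p + q)) ->
  (forall a p, 0 <= a -> C p -> C (a *: p)) ->
  C p ->
  (forall q, C q -> enorm (z - p) <= enorm (z - q)) -> moreau_pair C z p.
Proof.
move=> CD CZ Cp pmin.
have var u t : C (p + t *: u) -> 2 * t * dot (z - p) u <= t ^+ 2 * dot u u.
  move=> /pmin; rewrite enorm_le opprD addrA.
  move: (z - p) => w; rewrite !dot_lin (dotC u w); lra.
have key u : (forall t, 0 < t -> t <= 1 -> C (p + t *: u)) ->
    dot (z - p) u <= 0.
  move=> Cu; have : 2 * dot (z - p) u <= 0.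
    apply: (@lin_quad_le0 _ _ (dot u u)) => t t0 t1.
    by rewrite mulrA (mulrC t 2); apply: var; apply: Cu.
  by rewrite pmulr_rle0.
split => // [|q Cq]; last first.
  by apply: key => t t0 _; apply: CD => //; apply: CZ => //; exact: ltW.
apply/eqP; rewrite eq_le; apply/andP; split.
  by apply: key => t t0 _; apply: CD => //; apply: CZ => //; exact: ltW.
rewrite -oppr_le0 -dotNr; apply: key => t t0 t1.
rewrite scalerN -{1}(scale1r p) -scalerBl; apply: CZ => //.
by rewrite subr_ge0.
Qed.

Lemma sum_continuous (R : realType) (T : topologicalType) (I : finType)
    (F : I -> T -> R) :
  (forall i, continuous (F i)) -> continuous (fun t => \sum_i F i t).
Proof.
move=> Fc t; apply: (@cvg_big _ _ +%R 0 xpredT add_continuous _ (nbhs t)).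
by move=> i _; exact: Fc.
Qed.

Lemma sqr_dist_continuous (R : realType) (n : nat) (z : 'cV[R]_n) :
  continuous (fun q : 'cV[R]_n => dot (z - q) (z - q)).
Proof.
rewrite [X in continuous X](_ : _ =
    fun q : 'cV[R]_n => \sum_i (z i 0 - q i 0) * (z i 0 - q i 0)); last first.
  by apply/funext => q; rewrite dotE; apply: eq_bigr => i _; rewrite !mxE.
apply: sum_continuous => i q.
have co : z i 0 - q0 i 0 @[q0 --> q] --> z i 0 - q i 0.
  by apply: cvgB; [exact: cvg_cst | exact: coord_continuous].
exact: (cvgM co co).
Qed.

Lemma trmx_continuous (R : realType) (m n : nat) :
  continuous (@trmx R m n).
Proof.
move=> M s /= /nbhs_ballP[e e0 es].
by apply/nbhs_ballP; exists e => //= N [_ MN]; apply: es; split => // i j;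
  rewrite !mxE.
Qed.

(** The points of [C] at least as close to [z] as [q0] form a closed bounded
    set, on which the distance attains its minimum. The compactness theorem
    behind this speaks of row vectors, hence the transpositions. *)
Lemma closest_point_exists (R : realType) (n : nat) (C : set 'cV[R]_n) z :
  C !=set0 -> closed C ->
  exists2 p, C p & forall q, C q -> enorm (z - p) <= enorm (z - q).
Proof.
move=> [q0 Cq0] Ccl.
pose f (r : 'rV[R]_n) := dot (z - r^T) (z - r^T).
have fC : continuous f.
  move=> r; apply: (@continuous_comp _ _ _ (@trmx R 1 n)
    (fun q : 'cV[R]_n => dot (z - q) (z - q))).
    exact: trmx_continuous.
  exact: sqr_dist_continuous.
pose S : set 'rV[R]_n := (trmx @^-1` C) `&` (f @^-1` [set x | x <= f q0^T]).
have S0 : S !=set0 by exists q0^T; split => /=; rewrite ?trmxK.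
have Scl : closed S.
  apply: closedI.
    by apply: (continuous_closedP _).1 Ccl; exact: trmx_continuous.
  exact: (continuous_closedP f).1 fC _ (@closed_le R (f q0^T)).
have Sbd : bounded_set S.
  exists (enorm z + Num.sqrt (f q0^T)); split; first exact: num_real.
  move=> M ltM r [_ /= rS].
  have rn : enorm r^T <= M.
    apply: le_trans (ltW ltM).
    have -> : r^T = z + (- 1) *: (z - r^T).
      by rewrite scaleN1r opprB addrCA subrr addr0.
    apply: le_trans (enormD _ _) _; rewrite enormZ normrN1 mul1r lerD2l.
    by rewrite enormE ler_sqrt // dot_ge0.
  rewrite [leLHS]/Num.norm /= mx_normrE; apply/bigmax_leP; split.
    exact: le_trans (enorm_ge0 _) rn.
  move=> [i j] _ /=; rewrite ord1; apply: le_trans rn.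
  rewrite -ler_sqr ?nnegrE ?enorm_ge0 // real_normK ?num_real // sqr_enorm dotE.
  rewrite (bigD1 j) //= mxE -expr2 lerDl; apply: sumr_ge0 => k _.
  by rewrite -expr2 sqr_ge0.
have [|r] := compact_EVT_min S0 (bounded_closed_compact Sbd Scl) (f := f).
  by apply: continuous_subspaceT => ?; exact: fC.
rewrite inE => -[Cr /= rq0] rmin; exists r^T => // q Cq; rewrite enorm_le.
have [le|/ltW le] := leP (f q^T) (f q0^T).
  have := rmin q^T; rewrite inE /f trmxK; apply.
  by split => //=; rewrite trmxK.
have := le_trans rq0 le; rewrite /f trmxK; exact.
Qed.

(** * The positive semidefinite cone *)

Definition psd_cone {R : realType} {h : nat} : set 'cV[R]_(svec_dim h) :=
  [set z | psdmx (smat z)].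

Section PsdCone.
Context {R : realType} {h : nat}.
Implicit Types z q : 'cV[R]_(svec_dim h).

Lemma smatD z q : smat (z + q) = smat z + smat q.
Proof. by apply/matrixP => i j; rewrite !mxE mulrDr. Qed.

Lemma smatZ (a : R) z : smat (a *: z) = a *: smat z.
Proof. by apply/matrixP => i j; rewrite !mxE mulrCA. Qed.

Lemma smat_sym z : (smat z)^T = smat z.
Proof. by apply/matrixP => i j; rewrite !mxE triu_posC eq_sym. Qed.

Lemma psdmx_smatP z :
  psdmx (smat z) <-> forall x, 0 <= dot x (smat z *m x).
Proof.
by rewrite /psdmx smat_sym /dot; split => [[_ zx] x|zx]; [|split => // x];
  have := zx x; rewrite mulmxA.
Qed.

Local Notation K := (@psd_cone R h).

Lemma psd0 : K 0.
Proof.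
apply/psdmx_smatP => x; rewrite -(scale0r (0 : 'cV[R]_(svec_dim h))).
by rewrite smatZ scale0r mul0mx dot0r.
Qed.

Lemma psdD z q : K z -> K q -> K (z + q).
Proof.
move=> /psdmx_smatP zK /psdmx_smatP qK; apply/psdmx_smatP => x.
by rewrite smatD mulmxDl dotDr addr_ge0.
Qed.

Lemma psdZ a z : 0 <= a -> K z -> K (a *: z).
Proof.
move=> a0 /psdmx_smatP zK; apply/psdmx_smatP => x.
by rewrite smatZ -scalemxAl dotZr mulr_ge0.
Qed.

(** An intersection over all [x] of closed half-spaces, as [<x, smat z x>] is
    linear in [z]. *)
Lemma psd_closed : closed K.
Proof.
have -> : K = \bigcap_(x in setT) [set z | 0 <= dot x (smat z *m x)].
  apply/seteqP; split => [z /psdmx_smatP zK x _|z zK]; first exact: zK.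
  by apply/psdmx_smatP => x; exact: zK.
apply: closed_bigI => x _.
have cont : continuous (fun z => dot x (smat z *m x)).
  rewrite [X in continuous X](_ : _ = fun z => \sum_i \sum_j
      x i 0 * (if i == j then 1 else (Num.sqrt 2)^-1) * x j 0
      * z (triu_pos i j) 0); last first.
    apply/funext => z; rewrite dotE; apply: eq_bigr => i _.
    rewrite mxE mulr_sumr; apply: eq_bigr => j _.
    by rewrite [smat z i j]mxE; case: (i == j); ring.
  apply: sum_continuous => i; apply: sum_continuous => j z.
  have co : q (triu_pos i j) 0 @[q --> z] --> z (triu_pos i j) 0.
    exact: coord_continuous.
  exact: (cvgM (cvg_cst _) co).
exact: (continuous_closedP _).1 cont _ (@closed_ge R 0).
Qed.

(** A closest point exists, so the choice made in [psd_proj] returns one. Only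
    these conditions on the projection enter the rest of the argument. *)
Lemma psd_projP z : moreau_pair K z (psd_proj z).
Proof.
have [p Kp pmin] := closest_point_exists z (ex_intro _ _ psd0) psd_closed.
suff [Kp' pmin'] : (K (psd_proj z)) /\
    forall q, K q -> enorm (z - psd_proj z) <= enorm (z - q).
  exact: (closest_moreau_pair psdD psdZ Kp' pmin').
by rewrite /psd_proj; case: xgetP => [_ -> []//|/(_ p) []].
Qed.

End PsdCone.

(** * Gradients from quadratic remainder bounds *)

Lemma dot_is_linear (R : realType) (n : nat) (x : 'cV[R]_n) :
  linear_for *%R (dot x).
Proof. by move=> a y z; rewrite dotDr dotZr. Qed.

HB.instance Definition _ (R : realType) (n : nat) (x : 'cV[R]_n) :=
  GRing.isLinear.Build R 'cV[R]_n R *%R (dot x) (@dot_is_linear R n x).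

Lemma dot_continuous (R : realType) (n : nat) (x : 'cV[R]_n) :
  continuous (dot x).
Proof.
rewrite [X in continuous X](_ : _ =
    fun q : 'cV[R]_n => \sum_i x i 0 * q i 0); last first.
  by apply/funext => q; rewrite dotE.
apply: sum_continuous => i q.
have co : y i 0 @[y --> q] --> q i 0 by exact: coord_continuous.
exact: (cvgM (cvg_cst _) co).
Qed.

Lemma dot_le_mx_norm (R : realType) (n : nat) (x : 'cV[R]_n) :
  dot x x <= n%:R * `|x| ^+ 2.
Proof.
rewrite dotE mulr_natl -[X in _ *+ X]card_ord -sumr_const.
apply: ler_sum => i _; rewrite -expr2 -real_normK ?num_real //.
rewrite ler_sqr ?nnegrE // [leRHS]/Num.norm /= mx_normrE.
exact: (le_bigmax _ (fun ij => `|x ij.1 ij.2|) (i, 0)).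
Qed.

(** Differentiability asks for the expansion with the chosen differential
    ['d f x]; uniqueness identifies the latter with [df]. *)
Lemma littleo_differentiable (R : numFieldType) (V W : normedModType R)
    (f : V -> W) (df : {linear V -> W}) (x : V) :
  continuous df -> f \o shift x = cst (f x) + df +o_ 0 id ->
  differentiable f x /\ 'd f x = df :> (V -> W).
Proof.
move=> dfc exp; have dE := diff_unique dfc exp.
by split => //; apply/diff_locallyP; rewrite dE; split.
Qed.

(** A remainder of order [|u|^2] is [o(u)]; the squared Euclidean norm is at
    most [n] times the square of the max norm that defines the topology. *)
Lemma quadratic_remainder_gradient (R : realType) (n : nat)
    (f : 'cV[R]_n -> R) (x G : 'cV[R]_n) (C : R) :
  (forall u, `|f (x + u) - f x - dot G u| <= C * dot u u) ->
  differentiable f x /\ gradient f x = G.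
Proof.
move=> fC.
have [|df dE] :=
  littleo_differentiable (f := f) (x := x) (@dot_continuous R n G).
  apply/eqaddoP => _ /posnumP[e].
  have c0 : 0 < `|C| * n%:R + 1 by rewrite ltr_wpDl // mulr_ge0.
  have d0 : 0 < e%:num / (`|C| * n%:R + 1) by rewrite divr_gt0.
  have := nbhs0_lt (V := 'cV[R]_n) d0; apply: filterS => u.
  rewrite ltr_pdivlMr // mulrDr mulr1 (mulrC `|u|) => ue.
  rewrite [X in `|X|](_ : _ = f (x + u) - f x - dot G u); last first.
    by rewrite !fctE /= (addrC u) opprD addrA.
  apply: le_trans (fC u) _.
  apply: le_trans (ler_wpM2r (dot_ge0 u) (ler_norm C)) _.
  apply: le_trans (ler_wpM2l (normr_ge0 C) (dot_le_mx_norm u)) _.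
  rewrite expr2 !mulrA ler_wpM2r //.
  have := normr_ge0 u; lra.
split => //; apply/colP => i; rewrite mxE deriveE // dE /= dotE (bigD1 i) //=.
rewrite mxE !eqxx mulr1 big1 ?addr0 // => j ji.
by rewrite mxE (negbTE ji) mulr0.
Qed.

(** * Block estimates *)

Lemma sum_dot_adj (R : realType) (m k : nat) (d : 'I_k -> nat)
    (A : forall j, 'M[R]_(m, d j)) (x : 'cV[R]_m) :
  \sum_j dot ((A j)^T *m x) ((A j)^T *m x) =
  dot x ((\sum_j A j *m (A j)^T) *m x).
Proof.
rewrite mulmx_suml dot_sumr; apply: eq_bigr => j _.
by rewrite dot_adj trmxK mulmxA.
Qed.

(** With [v] the sum and [s] the spectral norm, [|v|^2 = \sum_j <A_j^T v, y_j>]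
    and [\sum_j |A_j^T v|^2 = <v, S v> <= s |v|^2], so this is Cauchy-Schwarz
    over the stacked blocks. It is done here by summing the inequalities
    [2 s <A_j^T v, y_j> <= |A_j^T v|^2 + s^2 |y_j|^2]. *)
Lemma dot_sum_mulmx_le (R : realType) (m k : nat) (d : 'I_k -> nat)
    (A : forall j, 'M[R]_(m, d j)) (y : forall j, 'cV[R]_(d j)) :
  dot (\sum_j A j *m y j) (\sum_j A j *m y j) <=
  spectral_norm (\sum_j A j *m (A j)^T) * \sum_j dot (y j) (y j).
Proof.
set v := \sum_j A j *m y j; set s := spectral_norm _.
have vE : dot v v = \sum_j dot ((A j)^T *m v) (y j).
  by rewrite {2}/v dot_sumr; apply: eq_bigr => j _; rewrite dot_adj trmxK.
have Av : \sum_j dot ((A j)^T *m v) ((A j)^T *m v) <= s * dot v v.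
  by rewrite sum_dot_adj; apply: le_trans (ler_norm _) (abs_dot_mulmx_le _ _).
(* For s = 0 the weighted inequalities say nothing about v, but then all
   A_j^T v vanish. *)
have [s0|sn0] := eqVneq s 0.
  rewrite s0 mul0r vE le_eqVlt big1 ?eqxx // => j _.
  rewrite [(A j)^T *m v]dot_eq0 ?(dotC 0) ?dot0r //; apply/eqP.
  rewrite eq_le dot_ge0 andbT; apply: le_trans _ (le_trans Av _).
    by rewrite (bigD1 j) //= lerDl; apply: sumr_ge0 => i _; exact: dot_ge0.
  by rewrite s0 mul0r.
have s0 : 0 < s by rewrite lt_def sn0 spectral_norm_ge0.
rewrite -(ler_pM2l s0).
have : 2 * s * dot v v <= s * dot v v + s ^+ 2 * \sum_j dot (y j) (y j).
  apply: le_trans (lerD Av (lexx _)).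
  rewrite {1}vE !mulr_sumr -big_split /=; apply: ler_sum => j _.
  have := dot_ge0 ((A j)^T *m v - s *: y j).
  rewrite !dot_lin (dotC (y j) ((A j)^T *m v)); lra.
rewrite expr2; lra.
Qed.

Lemma quadratic_form_expansion (R : realType) (n : nat) (M : 'M[R]_n)
    (c l u : 'cV[R]_n) : M^T = M ->
  - 2^-1 * dot (l + u) (M *m (l + u)) + dot (l + u) c =
  - 2^-1 * dot l (M *m l) + dot l c + dot (- (M *m l) + c) u
    - 2^-1 * dot u (M *m u).
Proof.
move=> M_sym; rewrite mulmxDr !dot_lin dot_adj M_sym (dotC c u).
have -> : dot u (M *m l) = dot l (M *m u) by rewrite dotC dot_adj M_sym.
lra.
Qed.

(** * Gradient of the dual function *)

Local Close Scope classical_set_scope.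

Theorem theorem3p6 (R : realType) (m nf msos : nat) (h : 'I_msos -> nat)
    (m_gt0 : (0 < m)%N) (nf_gt0 : (0 < nf)%N) (msos_gt0 : (0 < msos)%N)
    (h_gt0 : forall j, (0 < h j)%N)
    (Af : 'M[R]_(m, nf)) (wf : 'cV[R]_nf) (b : 'cV[R]_m)
    (Asos : forall j : 'I_msos, 'M[R]_(m, svec_dim (h j)))
    (wsos : forall j : 'I_msos, 'cV[R]_(svec_dim (h j)))
    (rho : R) (rho_gt0 : 0 < rho)
    (Q : 'M[R]_nf) (Q_pd : pdmx Q)
    (g : 'cV[R]_m -> R)
    (gE : forall l : 'cV[R]_m, g l =
      - 2^-1 * (l^T *m Af *m invmx Q *m Af^T *m l) 0 0
      + (l^T *m (Af *m invmx Q *m wf + b)) 0 0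
      - 2^-1 * (wf^T *m invmx Q *m wf) 0 0
      - rho / 2 * \sum_(j < msos)
          enorm (psd_proj (rho^-1 *: ((Asos j)^T *m l - wsos j))) ^+ 2) :
  [/\ forall l : 'cV[R]_m, differentiable g l,
      forall l : 'cV[R]_m, gradient g l =
        - (Af *m invmx Q *m Af^T *m l) + Af *m invmx Q *m wf + b
        - \sum_(j < msos)
            Asos j *m psd_proj (rho^-1 *: ((Asos j)^T *m l - wsos j))
    & forall x y : 'cV[R]_m,
        enorm (gradient g x - gradient g y) <=
        (spectral_norm (Af *m invmx Q *m Af^T)
         + rho^-1 * spectral_norm (\sum_(j < msos) Asos j *m (Asos j)^T))
        * enorm (x - y)].
Proof.
set M := Af *m invmx Q *m Af^T; set S := \sum_j _.
set p := fun l j => psd_proj (rho^-1 *: ((Asos j)^T *m l - wsos j)).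
pose z l j := rho^-1 *: ((Asos j)^T *m l - wsos j).
have pP l j : moreau_pair psd_cone (z l j) (p l j).
  exact: psd_projP.
have zB l u j : z (l + u) j - z l j = rho^-1 *: ((Asos j)^T *m u).
  by rewrite /z -scalerBr opprB addrA subrK mulmxDr addrC addKr.
have sum_zB l u : \sum_j dot (z (l + u) j - z l j) (z (l + u) j - z l j) <=
    rho^-1 ^+ 2 * spectral_norm S * dot u u.
  under eq_bigr do rewrite zB dotZl dotZr mulrA -expr2.
  rewrite -mulr_sumr -mulrA ler_wpM2l ?sqr_ge0 // sum_dot_adj.
  exact: le_trans (ler_norm _) (abs_dot_mulmx_le _ _).
have M_sym : M^T = M.
  by rewrite /M !trmx_mul trmxK trmx_inv Q_pd.1 mulmxA.
pose G l := - (M *m l) + Af *m invmx Q *m wf + b - \sum_j Asos j *m p l j.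
have g_grad l : differentiable g l /\ gradient g l = G l.
  apply: (@quadratic_remainder_gradient _ _ _ _ _
    (2^-1 * spectral_norm M + rho^-1 * spectral_norm S)) => u.
  have gE' l' : g l' = - 2^-1 * dot l' (M *m l')
      + dot l' (Af *m invmx Q *m wf + b)
      - 2^-1 * (wf^T *m invmx Q *m wf) 0 0
      - rho * \sum_j 2^-1 * dot (p l' j) (p l' j).
    rewrite gE /dot /M !mulmxA -mulr_sumr mulrA.
    by under eq_bigr do rewrite sqr_enorm.
  (* The quadratic part contributes its second-order term exactly; each
     projection term contributes its own first-order remainder. *)
  have -> : g (l + u) - g l - dot (G l) u = - 2^-1 * dot u (M *m u)
      - rho * \sum_j (2^-1 * dot (p (l + u) j) (p (l + u) j)
          - 2^-1 * dot (p l j) (p l j) - dot (p l j) (z (l + u) j - z l j)).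
    rewrite !sumrB.
    have -> : \sum_j dot (p l j) (z (l + u) j - z l j) =
        rho^-1 * dot (\sum_j Asos j *m p l j) u.
      rewrite dotC dot_sumr mulr_sumr; apply: eq_bigr => j _.
      by rewrite zB dotZr [dot u _]dotC dot_adj.
    rewrite !gE' quadratic_form_expansion // /G -[- _ + _ + b]addrA.
    rewrite [dot (_ - \sum_j _) u]dotDl dotNl !mulrBr mulVKf ?gt_eqF //.
    have cancel (q d v w k a c d' : R) :
      q + d - v * w - k - a - (q - k - c) - (d - d') = - v * w - (a - c - d').
      by ring.
    exact: cancel.
  apply: le_trans (ler_normB _ _) _; rewrite mulrDl lerD //.
    rewrite normrM normrN (ger0_norm (_ : 0 <= 2^-1)) ?invr_ge0 //.
    rewrite -mulrA ler_wpM2l ?invr_ge0 //.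
    exact: abs_dot_mulmx_le.
  rewrite normrM gtr0_norm // -ler_pdivlMl //.
  apply: le_trans (ler_norm_sum _ _ _) _.
  apply: le_trans (ler_sum _ (fun j _ =>
    half_sqr_moreau_expansion (pP l j) (pP (l + u) j))) _.
  by apply: le_trans (sum_zB l u) _; rewrite expr2 !mulrA.
split=> [l|l|x y]; [exact: (g_grad l).1 | exact: (g_grad l).2 |].
rewrite (g_grad x).2 (g_grad y).2.
have -> : G x - G y =
    - 1 *: (M *m (x - y)) + - 1 *: \sum_j Asos j *m (p x j - p y j).
  rewrite !scaleN1r /G mulmxBr.
  under [\sum_j Asos j *m (_ - _)]eq_bigr do rewrite mulmxBr.
  rewrite sumrB.
  have regroup (Mx My c s s' : 'cV[R]_m) :
    - Mx + c + b - s - (- My + c + b - s') = - (Mx - My) - (s - s').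
    by apply/colP => i; rewrite !mxE; ring.
  exact: regroup.
apply: le_trans (enormD _ _) _; rewrite !enormZ normrN1 !mul1r mulrDl.
rewrite lerD ?enorm_mulmx //.
have pB : \sum_j dot (p x j - p y j) (p x j - p y j) <=
    rho^-1 ^+ 2 * spectral_norm S * dot (x - y) (x - y).
  apply: le_trans (sum_zB y (x - y)); rewrite (addrC y) subrK.
  by apply: ler_sum => j _; exact: moreau_nonexpansive.
have s0 := spectral_norm_ge0 S.
have r0 : 0 <= rho^-1 by rewrite invr_ge0 ltW.
rewrite -ler_sqr ?nnegrE ?mulr_ge0 ?enorm_ge0 // sqr_enorm.
apply: le_trans (dot_sum_mulmx_le _ _) (le_trans (ler_wpM2l s0 pB) _).
rewrite -sqr_enorm !exprMn mulrCA [spectral_norm S ^+ 2]expr2.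
by rewrite !mulrA.
Qed.
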